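(* Let $x_0=1/\zeta(2)=6/\pi^2$ and $x_1=1/(\zeta(2)-1)$. As $n\to\infty$: \[ \Pr(D_n<x\log n)=n^{-\Lambda^*(x)+o(1)}\ \text{ for } 0<x\le x_0,\qquad \Pr(D_n>x\log n)=n^{-\Lambda^*(x)+o(1)}\ \text{ for } x_0\le x<x_1, \] \[ \Pr(D_n>x\log n)\le n^{-\Lambda^*(x)+o(1)}\ \text{ for } x\ge x_1. \]
   Context: $D_n$ is the absorption time at state 1 of the continuous-time Markov chain on $\{1,2,\dots\}$ started at $n$ that jumps from $m$ to $i$ at rate $1/(m-i)$ for $1\le i\le m-1$. $\psi=\Gamma'/\Gamma$ is the digamma function. For real $\lambda<1$, $\rho(\lambda)$ is the unique real number in $(-1,\infty)$ with $\psi(1+\rho(\lambda))-\psi(1)=\lambda$. Define $\Lambda^*(x)=\sup_{-\infty<\lambda<1}\{x\lambda-\rho(\lambda)\}$ for $x\in\mathbb{R}$ (the Fenchel–Legendre transform of $\Lambda(\lambda)=\rho(\lambda)$ for $\lambda<1$, $\Lambda(\lambda)=+\infty$ for $\lambda\ge1$). *)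

(* Defs.v *)
From HB Require Import structures.
From mathcomp Require Import all_boot all_order all_algebra.
From mathcomp Require Import all_classical all_reals all_analysis.
Set Implicit Arguments. Unset Strict Implicit. Unset Printing Implicit Defensive.
Import Order.TTheory GRing.Theory Num.Theory numFieldNormedType.Exports.
Local Open Scope classical_set_scope.
Local Open Scope ring_scope.

Section Defs.
Variable R : realType.

Definition euler_gamma : R :=
  limn (fun n : nat => \sum_(1 <= k < n.+1) (k%:R)^-1 - ln (n%:R)).

(* Digamma function psi = Gamma'/Gamma on (0,oo), via the classical series
   psi(z) = -gamma + sum_{k>=0} (1/(k+1) - 1/(k+z)). *)
Definition digamma (z : R) : R :=
  - euler_gamma + limn (series (fun k : nat => (k.+1%:R)^-1 - (k%:R + z)^-1) : R^nat).

(* rho(l) : the unique r in (-1,oo) with psi(1+r) - psi(1) = l. *)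
Definition rho (l : R) : R :=
  xget 0 [set r : R | -1 < r /\ digamma (1 + r) - digamma 1 = l].

(* Fenchel--Legendre transform of Lambda (= rho on (-oo,1), +oo elsewhere). *)
Definition LambdaStar (x : R) : \bar R :=
  ereal_sup [set ((x * l - rho l)%:E) | l in [set l : R | l < 1]].

Definition rate (m i : nat) : R := ((m - i)%N%:R)^-1.
Definition totrate (m : nat) : R := \sum_(1 <= i < m) rate m i.

(* First-step analysis: lawtbl k m S = Pr(D_m \in S) as soon as k >= m - 1.
   From m >= 2 the chain waits an Exp(totrate m) time s and then jumps to j
   with probability rate m j / totrate m; the joint density of (s, j) is
   rate m j * exp(- totrate m * s), and D_m = s + D_j (independent). *)
Fixpoint lawtbl (k : nat) : nat -> set R -> \bar R :=
  match k with
  | 0 => fun m S => if (m <= 1)%N then (\1_S (0 : R))%:E else 0%E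
  | k'.+1 => fun m S =>
      if (m <= 1)%N then (\1_S (0 : R))%:E
      else (\sum_(1 <= j < m)
              \int[@lebesgue_measure R]_(s in `[0%R, +oo[%classic)
                 ((rate m j * expR (- (totrate m * s)))%R%:E
                   * lawtbl k' j [set y | S (s + y)%R]))%E
  end.

(* Pr(D_n \in S) for the absorption time D_n of the chain started at n. *)
Definition PrD (n : nat) (S : set R) : \bar R := lawtbl n n S.

Definition x0 : R := 6 / pi ^+ 2.
Definition x1 : R := (pi ^+ 2 / 6 - 1)^-1.

End Defs.

(* Main.v *)
Require Import Defs.
From HB Require Import structures.
From mathcomp Require Import all_boot all_order all_algebra.
From mathcomp Require Import all_classical all_reals all_analysis.
From mathcomp Require Import ring lra zify.
Import Order.TTheory GRing.Theory Num.Theory numFieldNormedType.Exports.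
Local Open Scope classical_set_scope.
Local Open Scope ring_scope.

(* Conditioning on the first jump shows that f_l(m) = E exp(l D_m) satisfies (h_{m-1} - l) f_l(m) = sum_{i<m} f_l(i)/(m-i), with h the harmonic numbers. Since u_r(m) = Gamma(m+r)/Gamma(m) satisfies sum_{i<m} u_r(i)/(m-i) = (psi(m+r) - psi(1+r)) u_r(m), it is a super- or subsolution for large m as soon as psi(1+r) - psi(1) exceeds or is below l; hence f_l(n) = n^{rho(l)+o(1)} for l < 1. The upper bounds are then Chernoff's inequality.

For the lower bounds, the indicator of {y > x ln n} or {y < x ln n} dominates a combination of three exponentials exp(l_i y) which is of the right order in expectation (the Gaertner-Ellis tilting argument, without a change of measure). So the law of D_n only enters through its pairing with exponentials, and inequalities between an indicator and exponential sums pass through the first-jump recursion without any measurability question.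

Everything about rho is read off the series psi(1+r) - psi(1) = sum_k r/(k(k+r)) and psi'(1+r) = sum_k 1/(k+r)^2; the constants x0 and x1 need zeta(2) = pi^2/6, obtained from sum 1/sin^2 over the odd multiples of pi/2^{n+2}. *)

(** * First-jump recursion and exponential moments *)

Lemma le_integral_nomeas d (T : measurableType d) (R : realType)
    (mu : {measure set T -> \bar R}) (D : set T) (f g : T -> \bar R) :
  (forall x, D x -> (f x <= g x)%E) ->
  (\int[mu]_(x in D) f x <= \int[mu]_(x in D) g x)%E.
Proof.
move=> fg.
have le_fg x : ((f \_ D) x <= (g \_ D) x)%E.
  by rewrite !patchE; case: ifPn => // /set_mem /fg.
rewrite /integral; apply: leeB; apply: le_ereal_sup => _ [h hle <-];
  exists h => // x; apply: le_trans (hle x) _.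
- by rewrite !funeposE ge_max !le_max le_fg lexx orbT.
- by rewrite !funenegE ge_max !le_max leeN2 le_fg lexx orbT.
Qed.

Section ExponentialIntegral.
Variable R : realType.
Notation mu := (@lebesgue_measure R).

Lemma integrable_expRN (t : R) : 0 < t ->
  mu.-integrable `[0%R, +oo[%classic (fun s => (expR (- (t * s)))%:E).
Proof.
move=> t0; have int_pdf := integrable_exponential_pdf t0.
have : mu.-integrable `[0%R, +oo[%classic
    (fun s => (t^-1)%:E * (exponential_pdf t s)%:E)%E.
  apply: integrableZl => //.
  by apply: integrableS int_pdf.
apply: eq_integrable => // s; rewrite inE /= in_itv /= andbT => s0.
by rewrite exponential_pdfE// -EFinM mulrA mulVf ?gt_eqF// mul1r mulNr.
Qed.

Lemma integral_expRN (t : R) : 0 < t ->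
  (\int[mu]_(s in `[0%R, +oo[%classic) (expR (- (t * s)))%:E = (t^-1)%:E)%E.
Proof.
move=> t0; have int_pdf := integral_exponential_pdf t0.
have : (\int[mu]_(s in `[0%R, +oo[%classic) (t%:E * (expR (- (t * s)))%:E) = 1)%E.
  rewrite -int_pdf [RHS](_ : _ = \int[mu]_s
     (((fun s => (t%:E * (expR (- (t * s)))%:E)%E) \_ `[0%R, +oo[%classic) s))%E.
    by rewrite integral_mkcond.
  apply: eq_integral => s _; rewrite /exponential_pdf !patchE.
  by case: ifP => // _; rewrite mulNr EFinM.
rewrite integralZl//; last exact: integrable_expRN.
case: (\int[mu]_(s in _) _)%E => [r| |].
- rewrite -EFinM => -[tr]; congr EFin.
  by rewrite -[r](mulKf (lt0r_neq0 t0)) tr mulr1.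
- by rewrite gt0_muley ?lte_fin.
- by rewrite gt0_muleNy ?lte_fin.
Qed.

Lemma integral_expR_comb (a t : R) (N : nat) (c l : 'I_N -> R) :
  (forall i, l i < t) ->
  (\int[mu]_(s in `[0%R, +oo[%classic)
     ((a * expR (- (t * s)) * \sum_(i < N) c i * expR (l i * s))%R%:E)
   = (\sum_(i < N) a * c i / (t - l i))%R%:E)%E.
Proof.
move=> lt_t.
have tl i : 0 < t - l i by rewrite subr_gt0.
transitivity (\int[mu]_(s in `[0%R, +oo[%classic)
   (\sum_(i < N) (a * c i)%:E * (expR (- ((t - l i) * s)))%:E))%E.
  apply: eq_integral => s _.
  rewrite mulr_sumr -sumEFin; apply: eq_bigr => i _; rewrite -EFinM.
  congr EFin; rewrite mulrBl opprB expRD expRN; ring.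
rewrite integral_sum//; last first.
  by move=> i; apply: integrableZl => //; exact: integrable_expRN.
rewrite -sumEFin; apply: eq_bigr => i _.
by rewrite integralZl ?integral_expRN//; exact: integrable_expRN.
Qed.

End ExponentialIntegral.

Section MomentGenerating.
Variable R : realType.
Implicit Types l : R.

Fixpoint mgftbl l (k m : nat) : R :=
  if k is k'.+1 then
    if (m <= 1)%N then 1
    else (\sum_(1 <= j < m) rate R m j * mgftbl l k' j) / (totrate R m - l)
  else 1.

Lemma mgftbl_stable l (k k' m : nat) : (m <= k.+1)%N -> (m <= k'.+1)%N ->
  mgftbl l k m = mgftbl l k' m.
Proof.
elim: k k' m => [|k IH] [|k'] m //=; [by move=> -> | by move=> _ -> |].
move=> mk mk'; case: ifP => // _; congr (_ / _).
by apply: eq_big_nat => j /andP[_ jm]; rewrite (IH k')//; lia.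
Qed.

Definition mgf l (m : nat) : R := mgftbl l m m.

Lemma mgf1 l (m : nat) : (m <= 1)%N -> mgf l m = 1.
Proof. by case: m => [|[|]]. Qed.

Lemma mgfE l (m : nat) : (1 < m)%N ->
  mgf l m = (\sum_(1 <= j < m) rate R m j * mgf l j) / (totrate R m - l).
Proof.
case: m => // m m1; rewrite /mgf /= leqNgt m1 /=; congr (_ / _).
apply: eq_big_nat => j /andP[_ jm].
by rewrite (mgftbl_stable _ _ j)//; lia.
Qed.

Lemma rate_ge0 (m i : nat) : 0 <= rate R m i.
Proof. by rewrite /rate invr_ge0. Qed.

Lemma totrateE (m : nat) : totrate R m = \sum_(1 <= k < m) k%:R^-1.
Proof.
rewrite /totrate /rate big_nat_rev /=; apply: eq_big_nat => i /andP[i1 im].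
by congr (_%:R^-1); lia.
Qed.

Lemma totrate_ge1 (m : nat) : (1 < m)%N -> 1 <= totrate R m.
Proof.
move=> m1; rewrite totrateE big_ltn// invr1 lerDl.
by apply: sumr_ge0 => i _; rewrite invr_ge0.
Qed.

Section Combination.
Variables (N : nat) (l : 'I_N -> R).
Hypothesis l_lt1 : forall i, l i < 1.

Let comb_shift (c : 'I_N -> R) (s y : R) :
  \sum_(i < N) c i * expR (l i * s) * expR (l i * y) =
  \sum_(i < N) c i * expR (l i * (s + y)).
Proof. by apply: eq_bigr => i _; rewrite mulrDr expRD mulrA. Qed.

Let integral_step (m j : nat) (c : 'I_N -> R) : (1 < m)%N ->
  (\int[@lebesgue_measure R]_(s in `[0%R, +oo[%classic)
     ((rate R m j * expR (- (totrate R m * s)))%R%:E *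
      (\sum_(i < N) c i * expR (l i * s) * mgf (l i) j)%R%:E))%E =
  (\sum_(i < N) c i * (rate R m j * mgf (l i) j / (totrate R m - l i)))%R%:E.
Proof.
move=> m1.
transitivity (\int[@lebesgue_measure R]_(s in `[0%R, +oo[%classic)
  ((rate R m j * expR (- (totrate R m * s)) *
     \sum_(i < N) (c i * mgf (l i) j) * expR (l i * s))%R%:E))%E.
  apply: eq_integral => s _; rewrite -EFinM; congr (_ * _)%R%:E.
  by apply: eq_bigr => i _; rewrite mulrAC.
rewrite integral_expR_comb; last first.
  by move=> i; apply: lt_le_trans (totrate_ge1 _ m1).
by congr EFin; apply: eq_bigr => i _; ring.
Qed.

Let sum_step (m : nat) (c : 'I_N -> R) : (1 < m)%N ->
  \sum_(1 <= j < m)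
    \sum_(i < N) c i * (rate R m j * mgf (l i) j / (totrate R m - l i)) =
  \sum_(i < N) c i * mgf (l i) m.
Proof.
move=> m1; rewrite exchange_big /=; apply: eq_bigr => i _.
by rewrite -mulr_sumr mgfE// mulr_suml.
Qed.

Lemma lawtbl_le (k m : nat) (S : set R) (c : 'I_N -> R) : (m <= k.+1)%N ->
  (forall y, \1_S y <= \sum_(i < N) c i * expR (l i * y)) ->
  (lawtbl k m S <= (\sum_(i < N) c i * mgf (l i) m)%:E)%E.
Proof.
have base (m' : nat) (S' : set R) (c' : 'I_N -> R) : (m' <= 1)%N ->
    (forall y, \1_S' y <= \sum_(i < N) c' i * expR (l i * y)) ->
    \1_S' (0 : R) <= \sum_(i < N) c' i * mgf (l i) m'.
  move=> m1 /(_ 0) /le_trans; apply; apply: ler_sum => i _.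
  by rewrite mulr0 expR0 mgf1.
elim: k m S c => [|k IH] m S c mk Sc /=.
  by rewrite mk lee_fin; exact: base.
case: ltnP => m1; last by rewrite lee_fin; exact: base.
rewrite -sum_step// -sumEFin [leLHS]big_nat_cond [leRHS]big_nat_cond.
apply: lee_sum => j; rewrite andbT => /andP[j1 jm]; rewrite -integral_step//.
apply: le_integral_nomeas => s _; apply: lee_wpmul2l.
  by rewrite lee_fin mulr_ge0 ?rate_ge0 ?expR_ge0.
apply: IH; first lia.
by move=> y; rewrite comb_shift; exact: Sc (s + y).
Qed.

Lemma lawtbl_ge (k m : nat) (S : set R) (c : 'I_N -> R) : (m <= k.+1)%N ->
  (forall y, \sum_(i < N) c i * expR (l i * y) <= \1_S y) ->
  ((\sum_(i < N) c i * mgf (l i) m)%:E <= lawtbl k m S)%E.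
Proof.
have base (m' : nat) (S' : set R) (c' : 'I_N -> R) : (m' <= 1)%N ->
    (forall y, \sum_(i < N) c' i * expR (l i * y) <= \1_S' y) ->
    \sum_(i < N) c' i * mgf (l i) m' <= \1_S' (0 : R).
  move=> m1 /(_ 0); apply: le_trans; apply: ler_sum => i _.
  by rewrite mulr0 expR0 mgf1.
elim: k m S c => [|k IH] m S c mk Sc /=.
  by rewrite mk lee_fin; exact: base.
case: ltnP => m1; last by rewrite lee_fin; exact: base.
rewrite -sum_step// -sumEFin [leLHS]big_nat_cond [leRHS]big_nat_cond.
apply: lee_sum => j; rewrite andbT => /andP[j1 jm]; rewrite -integral_step//.
apply: le_integral_nomeas => s _; apply: lee_wpmul2l.
  by rewrite lee_fin mulr_ge0 ?rate_ge0 ?expR_ge0.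
apply: IH; first lia.
by move=> y; rewrite comb_shift; exact: Sc (s + y).
Qed.

End Combination.

End MomentGenerating.

(** * Growth of the moment generating function *)

Section Growth.
Variable R : realType.
Implicit Types (r l : R) (m n : nat).

(* [growth r m] is Gamma(m + r) / (Gamma(m) Gamma(1 + r)). *)
Definition growth r m : R := \prod_(1 <= k < m) ((k%:R + r) / k%:R).

Definition hsum r m : R := \sum_(1 <= k < m) (k%:R + r)^-1.

Lemma natD_gt0 r (k : nat) : -1 < r -> (0 < k)%N -> 0 < k%:R + r.
Proof.
move=> r1 k0; have : 1 <= k%:R :> R by rewrite ler1n.
lra.
Qed.

Lemma growthS r m : (0 < m)%N -> growth r m.+1 = growth r m * ((m%:R + r) / m%:R).
Proof. by move=> m0; rewrite /growth big_nat_recr. Qed.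

Lemma growth_gt0 r m : -1 < r -> 0 < growth r m.
Proof.
move=> r1; rewrite /growth big_nat; apply: prodr_gt0 => k /andP[k1 _].
by rewrite divr_gt0 ?natD_gt0// ltr0n.
Qed.

(* Both sides satisfy [m u(m+1) = (m + r) u(m) + growth r m]. *)
Lemma growth_rate_sum r m : -1 < r ->
  \sum_(1 <= j < m) rate R m j * growth r j = growth r m * hsum r m.
Proof.
move=> r1; case: m => [|m]; first by rewrite /hsum !big_geq ?mulr0.
elim: m => [|m IH]; first by rewrite /hsum !big_geq ?mulr0.
have m0 : m.+1%:R != 0 :> R by rewrite pnatr_eq0.
have mr0 : m.+1%:R + r != 0 by rewrite lt0r_neq0 ?natD_gt0.
apply: (mulfI m0).
transitivity ((m.+1%:R + r) * (growth r m.+1 * hsum r m.+1) + growth r m.+1);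
  last first.
  rewrite (growthS r m.+1)// /hsum [in RHS]big_nat_recr//= -/(hsum r m.+1).
  by move: (m.+1%:R : R) m0 mr0 => M ? ?; field; apply/andP.
rewrite -{}IH.
transitivity (\sum_(1 <= j < m.+2) growth r j +
   \sum_(1 <= j < m.+2) (j%:R - 1) * (rate R m.+2 j * growth r j)).
  rewrite mulr_sumr -big_split /=; apply: eq_big_nat => j /andP[j1 jm].
  have j0 : (m.+2 - j)%:R != 0 :> R by rewrite pnatr_eq0; lia.
  have -> : m.+1%:R = (m.+2 - j)%:R + (j%:R - 1) :> R.
    rewrite natrB; last lia.
    by rewrite -[m.+2]addn1 natrD; ring.
  by rewrite mulrDl /rate mulrA mulfV// mul1r.
have -> : \sum_(1 <= j < m.+2) (j%:R - 1) * (rate R m.+2 j * growth r j) =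
  \sum_(1 <= j < m.+1) (j%:R + r) * (rate R m.+1 j * growth r j).
  rewrite big_ltn// subrr mul0r add0r big_add1 /=.
  apply: eq_big_nat => j /andP[j1 jm].
  have j0 : j%:R != 0 :> R by rewrite pnatr_eq0; lia.
  rewrite growthS// /rate subSS -natr1; field.
  by rewrite j0 pnatr_eq0; lia.
have -> : \sum_(1 <= j < m.+1) (j%:R + r) * (rate R m.+1 j * growth r j) =
  (m.+1%:R + r) * (\sum_(1 <= j < m.+1) rate R m.+1 j * growth r j) -
  \sum_(1 <= j < m.+1) growth r j.
  rewrite mulr_sumr -sumrB; apply: eq_big_nat => j /andP[j1 jm].
  have : m.+1%:R - j%:R != 0 :> R by rewrite subr_eq0 eqr_nat; lia.
  by rewrite /rate natrB ?(ltnW jm)//; move: (m.+1%:R : R) => M ?; field.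
rewrite big_nat_recr//=; ring.
Qed.

Lemma mgf_gt0 l m : l < 1 -> 0 < mgf R l m.
Proof.
move=> l1; elim/ltn_ind: m => m IH.
have [m1|m1] := leqP m 1; first by rewrite mgf1.
rewrite mgfE//; apply: divr_gt0; last first.
  by rewrite subr_gt0 (lt_le_trans l1)// totrate_ge1.
rewrite big_ltn// ltr_pwDl//.
  by rewrite mulr_gt0 ?IH// /rate invr_gt0 ltr0n; lia.
rewrite big_nat; apply: sumr_ge0 => j /andP[_ jm].
by rewrite mulr_ge0 ?rate_ge0// ltW// IH.
Qed.

Lemma exists_ratio_bound (u v : nat -> R) (m0 : nat) :
  (forall m, 0 < u m) -> (forall m, 0 < v m) ->
  exists2 C : R, 0 < C & forall m, (m < m0)%N -> u m <= C * v m.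
Proof.
move=> u0 v0; exists (1 + \sum_(m < m0) u m / v m).
  by rewrite ltr_pwDl// sumr_ge0// => m _; rewrite ltW// divr_gt0.
move=> m mm0; rewrite -ler_pdivrMr// (bigD1 (Ordinal mm0))//= addrCA lerDl.
by rewrite addr_ge0// sumr_ge0// => i _; rewrite ltW// divr_gt0.
Qed.

Lemma mgf_le_growth r l (m0 : nat) : -1 < r -> l < 1 ->
  (forall m, (m0 <= m)%N -> l <= totrate R m - hsum r m) ->
  exists2 C : R, 0 < C & forall m, mgf R l m <= C * growth r m.
Proof.
move=> r1 l1 super.
have [C C0 small] := exists_ratio_bound (mgf R l) (growth r) (maxn m0 2)
  (fun m => mgf_gt0 l m l1) (fun m => growth_gt0 r m r1).
exists C => // m; elim/ltn_ind: m => m IH.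
have [|] := ltnP m (maxn m0 2); first exact: small.
rewrite geq_max => /andP[mm0 m1].
have t0 : 0 < totrate R m - l.
  by rewrite subr_gt0 (lt_le_trans l1)// totrate_ge1.
rewrite mgfE// ler_pdivrMr//.
apply: (@le_trans _ _ (\sum_(1 <= j < m) rate R m j * (C * growth r j))).
  rewrite big_nat_cond [leRHS]big_nat_cond; apply: ler_sum => j.
  rewrite andbT => /andP[_ jm].
  by rewrite ler_wpM2l ?rate_ge0// IH.
under eq_bigr do rewrite mulrCA.
rewrite -mulr_sumr growth_rate_sum// -mulrA ler_wpM2l ?(ltW C0)//.
rewrite ler_wpM2l ?(ltW (growth_gt0 _ _ r1))//.
by have := super m mm0; lra.
Qed.

Lemma growth_le_mgf r l (m0 : nat) : -1 < r -> l < 1 ->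
  (forall m, (m0 <= m)%N -> totrate R m - hsum r m <= l) ->
  exists2 C : R, 0 < C & forall m, growth r m <= C * mgf R l m.
Proof.
move=> r1 l1 sub.
have [C C0 small] := exists_ratio_bound (growth r) (mgf R l) (maxn m0 2)
  (fun m => growth_gt0 r m r1) (fun m => mgf_gt0 l m l1).
exists C => // m; elim/ltn_ind: m => m IH.
have [|] := ltnP m (maxn m0 2); first exact: small.
rewrite geq_max => /andP[mm0 m1].
have t0 : 0 < totrate R m - l.
  by rewrite subr_gt0 (lt_le_trans l1)// totrate_ge1.
rewrite mgfE// mulrA ler_pdivlMr//.
apply: (@le_trans _ _ (\sum_(1 <= j < m) rate R m j * growth r j)).
  rewrite growth_rate_sum// ler_wpM2l ?(ltW (growth_gt0 _ _ r1))//.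
  by have := sub m mm0; lra.
rewrite mulr_sumr big_nat_cond [leRHS]big_nat_cond; apply: ler_sum => j.
rewrite andbT => /andP[_ jm].
by rewrite mulrCA ler_wpM2l ?rate_ge0// IH.
Qed.

Lemma ln_le_totrate n : (0 < n)%N -> ln n%:R <= totrate R n.
Proof.
case: n => // n _; elim: n => [|n IH].
  by rewrite ln1 totrateE big_geq.
rewrite totrateE big_nat_recr//= -totrateE.
have n0 : 0 < n.+1%:R :> R by rewrite ltr0n.
have -> : n.+2%:R = n.+1%:R * (1 + n.+1%:R^-1) :> R.
  by rewrite mulrDr mulr1 mulfV ?gt_eqF// natr1.
have p0 : 0 < 1 + n.+1%:R^-1 :> R by rewrite addr_gt0 ?invr_gt0.
rewrite lnM ?posrE//.
apply: lerD => //; apply: le_ln1Dx.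
by rewrite (@lt_trans _ _ 0) ?ltrN10 ?invr_gt0.
Qed.

Lemma totrate_le_ln n : (0 < n)%N -> totrate R n <= 1 + ln n%:R.
Proof.
move=> n0; suff : totrate R n.+1 <= 1 + ln n%:R.
  by apply: le_trans; rewrite !totrateE big_nat_recr//= lerDl invr_ge0.
case: n n0 => // n _; elim: n => [|n IH].
  by rewrite ln1 totrateE big_nat1 invr1 addr0.
rewrite totrateE big_nat_recr//= -totrateE.
have n0 : 0 < n.+1%:R :> R by rewrite ltr0n.
have n2 : 0 < n.+2%:R :> R by rewrite ltr0n.
have E : n.+1%:R = n.+2%:R * (1 - n.+2%:R^-1) :> R.
  by rewrite mulrBr mulr1 mulfV ?gt_eqF// -[n.+2]addn1 natrD addrK.
have p0 : 0 < 1 - n.+2%:R^-1 :> R.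
  by rewrite subr_gt0 invf_lt1// ltr1n.
move: IH; rewrite [in ln _]E lnM ?posrE//.
have := @le_ln1Dx R (- n.+2%:R^-1).
rewrite ltrN2 invf_lt1// ltr1n => /(_ isT) lnB leT.
by rewrite -lerBrDr; apply: le_trans leT _; rewrite addrA lerD2l.
Qed.

Lemma growth_le_expR r m : -1 < r -> growth r m <= expR (r * totrate R m).
Proof.
move=> r1; rewrite totrateE mulr_sumr expR_sum /growth.
rewrite big_nat_cond [leRHS]big_nat_cond; apply: ler_prod => k.
rewrite andbT => /andP[k1 _]; have k0 : 0 < k%:R :> R by rewrite ltr0n.
rewrite divr_ge0 ?(ltW k0) ?(ltW (natD_gt0 _ _ r1 k1))//=.
apply: le_trans (expR_ge1Dx _).
by rewrite mulrDl mulfV ?gt_eqF.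
Qed.

Lemma expR_le_growth r m : -1 < r ->
  expR (r * totrate R m - r * (totrate R m - hsum r m)) <= growth r m.
Proof.
move=> r1.
rewrite -mulrBr opprB addrC subrK mulr_sumr expR_sum /growth.
rewrite big_nat_cond [leRHS]big_nat_cond; apply: ler_prod => k.
rewrite andbT => /andP[k1 _]; have k0 : 0 < k%:R :> R by rewrite ltr0n.
have kr := natD_gt0 _ _ r1 k1.
rewrite expR_ge0/=.
have : k%:R / (k%:R + r) <= expR (- (r * (k%:R + r)^-1)).
  apply: le_trans (expR_ge1Dx _).
  rewrite le_eqVlt; apply/orP; left; apply/eqP; field.
  exact: lt0r_neq0.
by rewrite expRN -invf_div lef_pV2 ?posrE ?expR_gt0 ?divr_gt0.
Qed.

Lemma growth_power_bounds r (M : R) : -1 < r ->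
  (forall m, `|totrate R m - hsum r m| <= M) ->
  exists2 C : R, 0 < C & forall n, (0 < n)%N ->
    growth r n <= C * expR (r * ln n%:R) /\ expR (r * ln n%:R) <= C * growth r n.
Proof.
move=> r1 hM; exists (expR (`|r| + `|r| * M)); first exact: expR_gt0.
have M0 : 0 <= M := le_trans (normr_ge0 _) (hM 0%N).
move=> n n0.
have tl : `|r * totrate R n - r * ln n%:R| <= `|r|.
  rewrite -mulrBr normrM ler_piMr//.
  have := ln_le_totrate n n0; have := totrate_le_ln n n0.
  by rewrite ler_norml => ? ?; apply/andP; split; lra.
have rM : `|r * (totrate R n - hsum r n)| <= `|r| * M.
  by rewrite normrM ler_wpM2l.
have rM0 : 0 <= `|r| * M by rewrite mulr_ge0.
move: tl rM; rewrite !ler_norml => /andP[t1 t2] /andP[m1 m2]; split.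
  apply: le_trans (growth_le_expR r n r1) _.
  by rewrite -expRD ler_expR; lra.
apply: (@le_trans _ _ (expR (`|r| + `|r| * M) *
   expR (r * totrate R n - r * (totrate R n - hsum r n)))).
  by rewrite -expRD ler_expR; lra.
by rewrite ler_wpM2l ?expR_ge0 ?expR_le_growth.
Qed.

End Growth.

(** * Digamma and trigamma series *)

Section DigammaSeries.
Variable R : realType.
Implicit Types (r s a x : R) (n k : nat).

Definition gterm r k : R := (k.+1%:R)^-1 - (k%:R + (1 + r))^-1.
Definition hterm r k : R := ((k%:R + (1 + r)) ^+ 2)^-1.

(* [gdiff r] is psi(1 + r) - psi(1), and [trigamma1 r] its derivative psi'(1 + r). *)
Definition gdiff r : R := limn (series (gterm r) : R^nat).
Definition trigamma1 r : R := limn (series (hterm r) : R^nat).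

Lemma shift_gt0 r k : -1 < r -> 0 < k%:R + (1 + r).
Proof. by move=> r1; have := ler0n R k; lra. Qed.

Lemma is_cvg_seriesM (u : R^nat) (c : R) : cvgn (series u) ->
  cvgn (series (fun k => c * u k)).
Proof. exact: (@is_cvg_seriesZ R u c). Qed.

Lemma lim_seriesM (u : R^nat) (c : R) : cvgn (series u) ->
  limn (series (fun k => c * u k)) = c * limn (series u).
Proof. exact: (@lim_seriesZ R u c). Qed.

Lemma is_cvg_series_invsq : cvgn (series (fun k => ((k.+1%:R : R) ^+ 2)^-1)).
Proof.
apply: nondecreasing_is_cvgn.
  by apply: nondecreasing_series => k _ _; rewrite invr_ge0 exprn_ge0.
exists 2 => _ [n _ <-]; rewrite /series /=.
apply: (@le_trans _ _ (\sum_(0 <= k < n.+1) ((k.+1%:R : R) ^+ 2)^-1)).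
  by rewrite big_nat_recr//= lerDl invr_ge0 exprn_ge0.
suff : \sum_(0 <= k < n.+1) ((k.+1%:R : R) ^+ 2)^-1 <= 2 - n.+1%:R^-1.
  by move=> /le_trans; apply; rewrite gerBl invr_ge0.
elim: n => [|n IH]; first by rewrite big_nat1 expr1n invr1; lra.
rewrite big_nat_recr//=; apply: le_trans (lerD IH (lexx _)) _.
have : 0 < n.+1%:R :> R by rewrite ltr0n.
rewrite -[n.+2%:R]natr1; move: (n.+1%:R : R) => a a0.
have a1 : 0 < a + 1 by lra.
rewrite -subr_ge0.
have -> : 2 - (a + 1)^-1 - (2 - a^-1 + ((a + 1) ^+ 2)^-1) =
  (a * (a + 1) ^+ 2)^-1 by field; rewrite !lt0r_neq0.
by rewrite invr_ge0 mulr_ge0 ?exprn_ge0 ?ltW.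
Qed.

Lemma is_cvg_series_invsq_bound (u : R^nat) (K : R) :
  (forall k, `|u k| <= K / k.+1%:R ^+ 2) -> cvgn (series u).
Proof.
move=> uK; apply: (@normed_cvg R R^o).
have K0 : 0 <= K by have := le_trans (normr_ge0 _) (uK 0%N); rewrite expr1n divr1.
apply: (@series_le_cvg R _ (fun k => K * ((k.+1%:R : R) ^+ 2)^-1)).
- by move=> k /=.
- by move=> k; rewrite mulr_ge0// invr_ge0 exprn_ge0.
- exact: uK.
- exact/is_cvg_seriesM/is_cvg_series_invsq.
Qed.

Lemma shift_inv_le r k : -1 < r ->
  (k%:R + (1 + r))^-1 <= (1 + (1 + r)^-1) / k.+1%:R.
Proof.
move=> r1; have kr := shift_gt0 r k r1; have r0 : 0 < 1 + r by lra.
rewrite ler_pdivlMr ?ltr0n// mulrC ler_pdivrMr//.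
have k0 := ler0n R k; rewrite -natr1.
have : (1 + r)^-1 * (1 + r) = 1 by rewrite mulVf ?gt_eqF.
have : 0 < (1 + r)^-1 by rewrite invr_gt0.
move: (1 + r)^-1 => q q0 qr; nra.
Qed.

Lemma gterm_frac r s k : -1 < r -> -1 < s ->
  gterm s k - gterm r k = (s - r) / ((k%:R + (1 + r)) * (k%:R + (1 + s))).
Proof.
move=> r1 s1; rewrite /gterm; have := shift_gt0 r k r1; have := shift_gt0 s k s1.
move=> /lt0r_neq0 ? /lt0r_neq0 ?; set t := _.+1%:R^-1.
by field; apply/andP.
Qed.

Lemma gterm0 k : gterm 0 k = 0.
Proof. by rewrite /gterm addr0 natr1 subrr. Qed.

Lemma gtermE r k : -1 < r -> gterm r k = r / (k.+1%:R * (k%:R + (1 + r))).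
Proof.
move=> r1; have := gterm_frac 0 r k (ltrN10 _) r1.
by rewrite gterm0 !subr0 addr0 natr1.
Qed.

Lemma is_cvg_gterm r : -1 < r -> cvgn (series (gterm r)).
Proof.
move=> r1; apply: (@is_cvg_series_invsq_bound _ (`|r| * (1 + (1 + r)^-1))) => k.
rewrite gtermE// normrM -mulrA ler_wpM2l//.
have kr := shift_gt0 r k r1.
rewrite ger0_norm; last by rewrite invr_ge0 mulr_ge0// ltW.
by rewrite invfM mulrC expr2 invfM mulrA ler_wpM2r ?invr_ge0 ?shift_inv_le.
Qed.

Lemma hterm_gt0 r k : -1 < r -> 0 < hterm r k.
Proof. by move=> r1; rewrite invr_gt0 exprn_gt0// shift_gt0. Qed.

Lemma is_cvg_hterm r : -1 < r -> cvgn (series (hterm r)).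
Proof.
move=> r1; apply: (@is_cvg_series_invsq_bound _ ((1 + (1 + r)^-1) ^+ 2)) => k.
rewrite ger0_norm ?(ltW (hterm_gt0 _ _ r1))// /hterm -expr_div_n -exprVn.
have q0 : 0 <= (1 + r)^-1 by rewrite invr_ge0; lra.
by rewrite lerXn2r ?nnegrE ?shift_inv_le ?invr_ge0 ?(ltW (shift_gt0 _ _ r1))
  ?divr_ge0 ?addr_ge0.
Qed.

Lemma gdiff_secant r s : -1 < r -> r < s ->
  (s - r) * trigamma1 s <= gdiff s - gdiff r <= (s - r) * trigamma1 r.
Proof.
move=> r1 rs; have s1 : -1 < s by lra.
have [cgr cgs] := (is_cvg_gterm r r1, is_cvg_gterm s s1).
have [chr chs] := (is_cvg_hterm r r1, is_cvg_hterm s s1).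
have sr : 0 <= s - r by lra.
rewrite /gdiff /trigamma1 -lim_seriesB// -!lim_seriesM//.
have bnd k : (s - r) * hterm s k <= gterm s k - gterm r k <= (s - r) * hterm r k.
  rewrite gterm_frac// /hterm; have kr := shift_gt0 r k r1.
  have ks := shift_gt0 s k s1.
  rewrite !ler_wpM2l//= lef_pV2 ?posrE ?mulr_gt0 ?exprn_gt0// expr2.
    by rewrite ler_wpM2l ?(ltW kr)//; lra.
  by rewrite ler_wpM2r ?(ltW ks)//; lra.
have cB : cvgn (series (gterm s - gterm r)) by exact: is_cvg_seriesB.
apply/andP; split; apply: lim_series_le => //; try exact: is_cvg_seriesM;
  by move=> k; have /andP[] := bnd k.
Qed.

Lemma series_le_lim (u : R^nat) n : (forall k, 0 <= u k) -> cvgn (series u) ->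
  series u n <= limn (series u).
Proof.
move=> u0 cu; apply: nondecreasing_cvgn_le => //.
by apply: nondecreasing_series => k _ _.
Qed.

Lemma trigamma1_ge r : -1 < r -> ((1 + r) ^+ 2)^-1 <= trigamma1 r.
Proof.
move=> r1; have := series_le_lim (hterm r) 1
  (fun k => ltW (hterm_gt0 r k r1)) (is_cvg_hterm r r1).
by rewrite /series /= big_nat1 /hterm add0r.
Qed.

Lemma trigamma1_gt0 r : -1 < r -> 0 < trigamma1 r.
Proof.
move=> r1; apply: lt_le_trans (trigamma1_ge r r1).
by rewrite invr_gt0 exprn_gt0//; lra.
Qed.

Lemma gdiff_lt r s : -1 < r -> r < s -> gdiff r < gdiff s.
Proof.
move=> r1 rs; have /andP[+ _] := gdiff_secant r s r1 rs.
have : 0 < (s - r) * trigamma1 s.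
  by rewrite mulr_gt0 ?trigamma1_gt0//; lra.
lra.
Qed.

Lemma trigamma1_lt r s : -1 < r -> r < s -> trigamma1 s < trigamma1 r.
Proof.
move=> r1 rs; have s1 : -1 < s by lra.
have lt k : hterm s k < hterm r k.
  have kr := shift_gt0 r k r1; have ks := shift_gt0 s k s1.
  by rewrite ltf_pV2 ?posrE ?exprn_gt0// ltr_pXn2r ?nnegrE ?ltW//; lra.
rewrite -subr_gt0 /trigamma1 -lim_seriesB; [|exact: is_cvg_hterm..].
apply: (@lt_le_trans _ _ (series (hterm r - hterm s) 1)).
  by rewrite /series /= big_nat1 subr_gt0.
apply: series_le_lim => [k|]; first by rewrite /= subr_ge0 ltW.
by apply: is_cvg_seriesB; exact: is_cvg_hterm.
Qed.

Lemma trigamma1_lipschitz a r s : -1 < a -> a <= r -> r < s ->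
  trigamma1 r - trigamma1 s <= (s - r) * (2 / (1 + a) * trigamma1 a).
Proof.
move=> a1 ar rs; have r1 : -1 < r by lra.
have s1 : -1 < s by lra.
rewrite mulrA /trigamma1 -lim_seriesB -?lim_seriesM; try exact: is_cvg_hterm.
apply: lim_series_le.
- by apply: is_cvg_seriesB; exact: is_cvg_hterm.
- by apply: is_cvg_seriesM; exact: is_cvg_hterm.
move=> k /=; rewrite -[leLHS]/(hterm r k - hterm s k) /hterm.
have := shift_gt0 a k a1; have k0 := ler0n R k.
have : k%:R + (1 + a) <= k%:R + (1 + r) by lra.
have : k%:R + (1 + r) < k%:R + (1 + s) by lra.
have : 1 + a <= k%:R + (1 + a) by lra.
have -> : s - r = (k%:R + (1 + s)) - (k%:R + (1 + r)) by ring.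
have : 0 < 1 + a by lra.
move: (1 + a) (k%:R + (1 + a)) (k%:R + (1 + r)) (k%:R + (1 + s)).
move=> c A B C c0 cA BC AB A0.
have [B0 C0] : 0 < B /\ 0 < C by split; lra.
have -> : (B ^+ 2)^-1 - (C ^+ 2)^-1 = (C - B) * (B^-1 * C^-1 * (B^-1 + C^-1)).
  by field; rewrite !lt0r_neq0.
rewrite -[leRHS]mulrA ler_wpM2l//; first lra.
have p0 : 0 < A^-1 by rewrite invr_gt0.
have t0 : 0 < C^-1 by rewrite invr_gt0.
have qp : B^-1 <= A^-1 by rewrite lef_pV2 ?posrE.
have tq : C^-1 <= B^-1 by rewrite lef_pV2 ?posrE ?ltW.
have tc : C^-1 <= c^-1 by rewrite lef_pV2 ?posrE//; lra.
rewrite -exprVn expr2 -[leRHS]mulrA.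
move: (A^-1) (B^-1) (C^-1) (c^-1) p0 t0 qp tq tc => p q t d p0 t0 qp tq td.
have q0 : 0 <= q by lra.
apply: (@le_trans _ _ (2 * (t * (q * q)))).
  have : 0 <= q * t * (q - t) by rewrite !mulr_ge0 ?subr_ge0 ?(ltW t0).
  lra.
by rewrite ler_wpM2l// ler_pM ?mulr_ge0 ?ler_pM ?(ltW t0).
Qed.

Lemma lipschitz_continuous (f : R -> R) (a K x : R) : a < x ->
  (forall r s, a <= r -> r < s -> `|f r - f s| <= K * (s - r)) ->
  {for x, continuous f}.
Proof.
move=> ax fK; have K0 : 0 <= K.
  have := fK x (x + 1) (ltW ax); rewrite addrAC subrr add0r mulr1 ltrDl ltr01.
  by move=> /(_ isT); apply: le_trans.
apply/cvgrPdist_lt => e e0; near=> y.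
have ay : a < y by near: y; exact: lt_nbhsr.
have xy : `|x - y| < e / (K + 1).
  by near: y; apply: cvgr_dist_lt; [exact: cvg_id|rewrite divr_gt0// ltr_wpDl].
suff : `|f x - f y| <= K * `|x - y|.
  move=> /le_lt_trans; apply; move: xy; rewrite ltr_pdivlMr ?ltr_wpDl//.
  by have := normr_ge0 (x - y); nra.
case: (ltgtP x y) => [lt|gt|->]; last by rewrite !subrr normr0 mulr0.
- by rewrite [X in K * X]distrC [`|y - x|]gtr0_norm ?subr_gt0// fK// ltW.
- by rewrite distrC [`|x - y|]gtr0_norm ?subr_gt0// fK// ltW.
Unshelve. all: by end_near. Qed.

Lemma continuous_gdiff x : -1 < x -> {for x, continuous gdiff}.
Proof.
move=> x1; pose a := (x - 1) / 2; have a1 : -1 < a by rewrite /a; lra.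
apply: (@lipschitz_continuous _ a (trigamma1 a)); first by rewrite /a; lra.
move=> r s ar rs; have r1 : -1 < r by lra.
have /andP[_ ub] := gdiff_secant r s r1 rs.
rewrite distrC gtr0_norm ?subr_gt0 ?gdiff_lt// (le_trans ub)// mulrC.
rewrite ler_wpM2r ?subr_ge0 ?(ltW rs)//.
by move: ar; rewrite le_eqVlt => /predU1P[->//|ar]; rewrite ltW// trigamma1_lt.
Qed.

Lemma continuous_trigamma1 x : -1 < x -> {for x, continuous trigamma1}.
Proof.
move=> x1; pose a := (x - 1) / 2; have a1 : -1 < a by rewrite /a; lra.
apply: (@lipschitz_continuous _ a (2 / (1 + a) * trigamma1 a)).
  by rewrite /a; lra.
move=> r s ar rs; have r1 : -1 < r by lra.
rewrite gtr0_norm ?subr_gt0 ?trigamma1_lt// mulrC.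
exact: trigamma1_lipschitz.
Qed.

Lemma gdiff0 : gdiff 0 = 0.
Proof.
rewrite /gdiff (_ : series (gterm 0) = cst 0) ?lim_cst//.
by apply/funext => n; rewrite /series /= big1// => k _; rewrite gterm0.
Qed.

Lemma gdiff1 : gdiff 1 = 1.
Proof.
apply: cvg_lim => //.
have -> : series (gterm 1) = (fun n => 1 - harmonic n).
  apply/funext => n; rewrite /series /harmonic /=; elim: n => [|n IH].
    by rewrite big_geq// invr1 subrr.
  rewrite big_nat_recr//= IH /gterm -[in X in _ + X]natr1 -!natr1 addrA.
  by set p := (_ + 1 + 1)^-1; rewrite addrA subrK.
rewrite -[X in _ --> X]subr0; apply: cvgB; first exact: cvg_cst.
exact: cvg_harmonic.
Qed.

Lemma gdiff_le r : -1 < r -> gdiff r <= trigamma1 0 * r.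
Proof.
move=> r1; have [r0|r0|->] := ltgtP r 0; last by rewrite gdiff0 mulr0.
- have /andP[+ _] := gdiff_secant r 0 r1 r0.
  by rewrite gdiff0 !sub0r mulNr lerN2 mulrC.
- have /andP[_] := gdiff_secant 0 r (ltrN10 _) r0.
  by rewrite gdiff0 !subr0 mulrC.
Qed.

Lemma gdiff_surj (l : R) : l < 1 -> exists2 r, -1 < r < 1 & gdiff r = l.
Proof.
move=> l1; pose a := (2 + `|l|)^-1 - 1 : R.
have l0 := normr_ge0 l.
have q0 : 0 < (2 + `|l|)^-1 by rewrite invr_gt0; lra.
have q1 : (2 + `|l|)^-1 < 1 by rewrite invf_lt1; lra.
have a1 : -1 < a by rewrite /a; lra.
have a0 : a < 0 by rewrite /a; lra.
have gal : gdiff a <= l.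
  have : 0 <= - gdiff a - (1 + `|l|).
    have cN : cvgn (series (- gterm a)) 
      by rewrite is_cvg_seriesN; exact: is_cvg_gterm.
    rewrite /gdiff -lim_seriesN; last exact: is_cvg_gterm.
    rewrite subr_ge0; apply: le_trans (series_le_lim _ 1 _ cN).
      rewrite /series /= big_nat1 /gterm -[leRHS]/(- _) invr1 add0r.
      by rewrite (_ : 1 + a = (2 + `|l|)^-1) ?invrK /a; lra.
    move=> k; rewrite -[leRHS]/(- _) oppr_ge0 gtermE//.
    rewrite mulr_le0_ge0 ?(ltW a0)// invr_ge0 mulr_ge0//.
    exact: ltW (shift_gt0 _ _ _).
  by have := ler_norm (- l); rewrite normrN; lra.
have [r] : exists2 c, c \in `[a, 1] & gdiff c = l.
  apply: IVT; first lra.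
    apply: continuous_in_subspaceT => x /set_mem /=; rewrite in_itv /= => /andP[ax _].
    by apply: continuous_gdiff; lra.
  by rewrite gdiff1 ge_min gal le_max (ltW l1) orbT.
rewrite in_itv /= => /andP[ar r1] gr; exists r => //.
rewrite (lt_le_trans a1 ar)/= lt_neqAle r1 andbT.
by apply/eqP => r_1; move: l1; rewrite -gr r_1 gdiff1 ltxx.
Qed.

Lemma trigamma1_surj (y : R) : trigamma1 1 < y ->
  exists2 r, -1 < r < 1 & trigamma1 r = y.
Proof.
move=> y1; pose a := (2 + y)^-1 - 1 : R.
have y0 : 0 < y by apply: lt_trans y1; apply: trigamma1_gt0; lra.
have q0 : 0 < (2 + y)^-1 by rewrite invr_gt0; lra.
have q1 : (2 + y)^-1 < 1 by rewrite invf_lt1; lra.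
have a1 : -1 < a by rewrite /a; lra.
have ya : y <= trigamma1 a.
  apply: le_trans (trigamma1_ge a a1).
  rewrite (_ : 1 + a = (2 + y)^-1); last by rewrite /a; lra.
  by rewrite exprVn invrK; nra.
have [r] : exists2 c, c \in `[a, 1] & trigamma1 c = y.
  apply: IVT; first by rewrite /a; lra.
    apply: continuous_in_subspaceT => x /set_mem /=; rewrite in_itv /= => /andP[ax _].
    by apply: continuous_trigamma1; lra.
  by rewrite ge_min (ltW y1) orbT le_max ya.
rewrite in_itv /= => /andP[ar r1] hr; exists r => //.
rewrite (lt_le_trans a1 ar)/= lt_neqAle r1 andbT.
by apply/eqP => r_1; move: y1; rewrite -hr r_1 ltxx.
Qed.

Lemma trigamma1_shift : trigamma1 1 = trigamma1 0 - 1.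
Proof.
apply: cvg_lim => //.
have -> : series (hterm 1) = (fun n => series (hterm 0) n.+1 - 1).
  apply/funext => n; rewrite /series /= big_nat_recl//.
  have -> : hterm 0 0 = 1 by rewrite /hterm addr0 add0r expr1n invr1.
  rewrite addrAC subrr add0r; apply: eq_bigr => k _.
  by rewrite /hterm addr0 -natr1 addrA.
apply: cvgB; last exact: cvg_cst.
by rewrite cvg_shiftS; apply: is_cvg_hterm.
Qed.

Lemma digamma_gdiff r : digamma (1 + r) - digamma 1 = gdiff r :> R.
Proof.
rewrite /digamma (_ : series (fun k => _ - (k%:R + 1)^-1) = cst 0).
  by rewrite lim_cst// addr0 addrC addKr.
apply/funext => n; rewrite /series /= big1// => k _.
by rewrite natr1 subrr.
Qed.

Lemma gdiff_inj r s : -1 < r -> -1 < s -> gdiff r = gdiff s -> r = s.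
Proof.
move=> r1 s1 rs; case: (ltgtP r s) => // lt.
- by have := gdiff_lt r s r1 lt; rewrite rs ltxx.
- by have := gdiff_lt s r s1 lt; rewrite rs ltxx.
Qed.

Lemma rho_gdiff r : -1 < r -> rho (gdiff r) = r.
Proof.
move=> r1; rewrite /rho; case: xgetP => [s _ [s1]|/(_ r)].
  by rewrite digamma_gdiff => /gdiff_inj; exact.
by case; split => //; exact: digamma_gdiff.
Qed.

Lemma totrateB_hsum r m : totrate R m.+1 - hsum R r m.+1 = series (gterm r) m.
Proof.
rewrite totrateE /hsum -sumrB big_add1 /= /series /=.
by apply: eq_bigr => k _; rewrite /gterm -natr1 -addrA.
Qed.

End DigammaSeries.

(** * Basel problem *)

Section Basel.
Variable R : realType.
Implicit Types (x : R) (n k : nat).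
Local Notation pi := (@pi R).

Lemma sin_le_id x : 0 < x -> sin x <= x.
Proof.
move=> x0; have [|c _] := @MVT R sin cos 0 x x0 (fun c _ => is_derive_sin c).
  by apply: continuous_subspaceT => y; exact: continuous_sin.
by rewrite sin0 !subr0 => ->; rewrite ler_piMl ?cos_le1// ltW.
Qed.

Lemma id_le_tan x : 0 < x < pi / 2 -> x <= tan x.
Proof.
move=> /andP[x0 xpi].
have cos_gt0 y : 0 <= y <= x -> 0 < cos y.
  by move=> /andP[y0 yx]; apply: cos_gt0_pihalf; have := pi_gt0 R; lra.
have [||c] := @MVT R tan (fun c => (cos c) ^- 2) 0 x x0.
- move=> c; rewrite in_itv /= => /andP[c0 cx]; apply: is_derive_tan.
  by rewrite lt0r_neq0// cos_gt0// (ltW c0) (ltW cx).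
- apply: continuous_in_subspaceT => c /set_mem /=; rewrite in_itv /= => cx.
  by apply: continuous_tan; rewrite lt0r_neq0// cos_gt0.
rewrite in_itv /= => /andP[c0 cx]; rewrite tan0 !subr0 => ->.
have c1 : 0 < cos c by rewrite cos_gt0// (ltW c0) (ltW cx).
by rewrite ler_peMl ?(ltW x0)// invf_ge1 ?exprn_gt0// exprn_ile1 ?cos_le1// ltW.
Qed.

Lemma invsq_sin_bounds x : 0 < x < pi / 2 ->
  (sin x ^+ 2)^-1 - 1 <= (x ^+ 2)^-1 <= (sin x ^+ 2)^-1.
Proof.
move=> xI; have /andP[x0 xpi] := xI.
have s0 : 0 < sin x by exact: sin_gt0_pihalf.
have c0 : 0 < cos x by apply: cos_gt0_pihalf; have := pi_gt0 R; lra.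
apply/andP; split; last first.
  by rewrite lef_pV2 ?posrE ?exprn_gt0// lerXn2r ?nnegrE ?(ltW x0) ?(ltW s0) ?sin_le_id.
have -> : (sin x ^+ 2)^-1 - 1 = (tan x ^+ 2)^-1.
  rewrite /tan expr_div_n invf_div cos2sin2 mulrBl mul1r mulfV//.
  by rewrite expf_neq0// lt0r_neq0.
have t0 : 0 < tan x by rewrite divr_gt0.
by rewrite lef_pV2 ?posrE ?exprn_gt0// lerXn2r ?nnegrE ?(ltW x0) ?(ltW t0)
  ?id_le_tan.
Qed.

Definition basel_angle n k : R := (k.*2.+1)%:R * pi / (2 ^+ n.+2).

(* [1/sin^2(x/2) + 1/cos^2(x/2) = 4/sin^2(x)], and the halved angles together with their complements are the angles of the next level. *)
Lemma sum_invsq_sin n :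
  \sum_(0 <= k < 2 ^ n) (sin (basel_angle n k) ^+ 2)^-1 = 2 * 4 ^+ n :> R.
Proof.
elim: n => [|n IH].
  rewrite expn0 big_nat1 /basel_angle mul1r mulr1.
  have -> : pi / 2 ^+ 2 = pi / 4 by congr (_ / _); ring.
  have c0 : 0 < cos (pi / 4) by apply: cos_gt0_pihalf; have := pi_gt0 R; lra.
  have := tan_piquarter R; rewrite /tan => /(congr1 (fun t => t * cos (pi / 4))).
  rewrite mul1r divfK ?lt0r_neq0// => sc; have := cos2Dsin2 (pi / 4).
  rewrite sc => h; have -> : cos (pi / 4) ^+ 2 = 2^-1 by lra.
  by rewrite invrK.
have e2 : (2 ^ n.+1 = 2 ^ n + 2 ^ n)%N by rewrite expnS mul2n addnn.
have e2R : 2 ^+ n.+1 = (2 ^ n.+1)%:R :> R by rewrite natrX.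
have -> : \sum_(0 <= k < 2 ^ n.+1) (sin (basel_angle n.+1 k) ^+ 2)^-1 =
  \sum_(0 <= k < 2 ^ n) ((sin (basel_angle n.+1 k) ^+ 2)^-1 +
     (sin (basel_angle n.+1 (2 ^ n.+1 - k.+1)) ^+ 2)^-1).
  rewrite big_split /= (@big_cat_nat _ _ _ (2 ^ n))//=; last by rewrite e2 leq_addr.
  congr (_ + _); rewrite -{1}[(2 ^ n)%N]add0n big_addn e2 addnK big_nat_rev /=.
  apply: eq_big_nat => k /andP[_ kn]; congr ((sin (basel_angle n.+1 _) ^+ 2)^-1).
  lia.
have -> : 2 * 4 ^+ n.+1 = 4 * (2 * 4 ^+ n) :> R by rewrite exprS; ring.
rewrite -IH mulr_sumr; apply: eq_big_nat => k /andP[_ kn].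
set t := basel_angle n.+1 k.
have -> : basel_angle n.+1 (2 ^ n.+1 - k.+1) = pi / 2 - t.
  have kk : (k.+1 <= 2 ^ n.+1)%N by rewrite e2; lia.
  rewrite /t /basel_angle (exprS _ n.+2) (exprS _ n.+1).
  have -> : ((2 ^ n.+1 - k.+1).*2.+1)%:R = 2 * 2 ^+ n.+1 - (k.*2.+1)%:R :> R.
    by rewrite e2R -natrM -natrB; [congr (_%:R); lia|lia].
  have : 2 ^+ n.+1 != 0 :> R by rewrite expf_neq0.
  by move: (2 ^+ n.+1 : R) (k.*2.+1%:R : R) => P K P0; field.
have -> : basel_angle n k = t *+ 2.
  rewrite /t /basel_angle -mulr_natr (exprS _ n.+2).
  have : 2 ^+ n.+2 != 0 :> R by rewrite expf_neq0.
  by move: (2 ^+ n.+2 : R) (k.*2.+1%:R : R) => P K P0; field.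
have tI : 0 < t < pi / 4.
  rewrite /t /basel_angle divr_gt0 ?exprn_gt0 ?mulr_gt0 ?pi_gt0//=.
  rewrite 2!exprS ltr_pdivrMr; last by rewrite !mulr_gt0 ?exprn_gt0.
  rewrite e2R (_ : pi / 4 * _ = (2 ^ n.+1)%:R * pi); last by field.
  by rewrite ltr_pM2r ?pi_gt0// ltr_nat e2; lia.
have s0 : 0 < sin t by apply: sin_gt0_pihalf; lra.
have c0 : 0 < cos t by apply: cos_gt0_pihalf; have := pi_gt0 R; lra.
rewrite sinB sin_pihalf cos_pihalf mul1r mul0r subr0 sin_mulr2n.
transitivity ((cos t ^+ 2 + sin t ^+ 2) / (sin t ^+ 2 * cos t ^+ 2)).
  by field; rewrite !lt0r_neq0.
by rewrite cos2Dsin2 -mulr_natr; field; rewrite !lt0r_neq0.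
Qed.

Lemma sum_invsq_odd_bounds n :
  pi ^+ 2 / 8 - pi ^+ 2 / 16 / 2 ^+ n <=
  \sum_(0 <= k < 2 ^ n) ((k.*2.+1)%:R ^+ 2)^-1 <= pi ^+ 2 / 8.
Proof.
have pi0 := pi_gt0 R; have p2 : 0 < 2 ^+ n :> R by rewrite exprn_gt0.
have E : \sum_(0 <= k < 2 ^ n) ((k.*2.+1)%:R ^+ 2)^-1 =
    pi ^+ 2 / (2 ^+ n.+2) ^+ 2 *
    \sum_(0 <= k < 2 ^ n) (basel_angle n k ^+ 2)^-1 :> R.
  rewrite mulr_sumr; apply: eq_bigr => k _; rewrite /basel_angle.
  have : (k.*2.+1)%:R != 0 :> R by rewrite pnatr_eq0.
  have : 2 ^+ n.+2 != 0 :> R by rewrite expf_neq0.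
  have := lt0r_neq0 pi0.
  move: (2 ^+ n.+2 : R) (k.*2.+1%:R : R) pi => P K p p_ P_ K_; field.
  by rewrite p_ P_ K_.
have f4 : 4 ^+ n = (2 ^+ n) ^+ 2 :> R.
  by rewrite -exprM mulnC exprM; congr (_ ^+ _); ring.
have c0 : 0 <= pi ^+ 2 / (2 ^+ n.+2) ^+ 2.
  by rewrite divr_ge0 ?exprn_ge0// ltW.
have angleI k : (k < 2 ^ n)%N -> 0 < basel_angle n k < pi / 2.
  move=> kn; rewrite /basel_angle divr_gt0 ?exprn_gt0 ?mulr_gt0//=.
  rewrite exprS ltr_pdivrMr ?mulr_gt0 ?exprn_gt0//.
  rewrite mulrA divfK// mulrC ltr_pM2l// -natrX ltr_nat expnS; lia.
rewrite E; apply/andP; split.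
- apply: (@le_trans _ _ (pi ^+ 2 / (2 ^+ n.+2) ^+ 2 *
    (\sum_(0 <= k < 2 ^ n) ((sin (basel_angle n k) ^+ 2)^-1 - 1)))).
    rewrite sumrB sum_invsq_sin big_const_nat subn0 iter_addr_0 natrX f4 (exprS _ n.+1) (exprS _ n).
    rewrite le_eqVlt; apply/orP; left; apply/eqP; move: p2.
    by move: (2 ^+ n : R) => P P0; field; rewrite lt0r_neq0.
  rewrite ler_wpM2l// big_nat_cond [leRHS]big_nat_cond.
  apply: ler_sum => k; rewrite andbT => /andP[_ /angleI].
  by move=> /invsq_sin_bounds/andP[].
- apply: (@le_trans _ _ (pi ^+ 2 / (2 ^+ n.+2) ^+ 2 *
    (\sum_(0 <= k < 2 ^ n) (sin (basel_angle n k) ^+ 2)^-1))).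
    rewrite ler_wpM2l// big_nat_cond [leRHS]big_nat_cond.
    apply: ler_sum => k; rewrite andbT => /andP[_ /angleI].
    by move=> /invsq_sin_bounds/andP[].
  rewrite sum_invsq_sin f4 (exprS _ n.+1) (exprS _ n).
  rewrite le_eqVlt; apply/orP; left; apply/eqP; move: p2.
  by move: (2 ^+ n : R) => P P0; field; rewrite lt0r_neq0.
Qed.

Lemma sum_invsq_split (N : nat) :
  \sum_(0 <= k < N.*2) ((k.+1)%:R ^+ 2)^-1 =
  \sum_(0 <= k < N) ((k.*2.+1)%:R ^+ 2)^-1 +
  4^-1 * \sum_(0 <= k < N) ((k.+1)%:R ^+ 2)^-1 :> R.
Proof.
elim: N => [|N IH]; first by rewrite !big_geq// mulr0 addr0.
rewrite doubleS !big_nat_recr//= IH.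
have -> : N.*2.+2%:R = 2 * N.+1%:R :> R by rewrite -natrM mul2n.
rewrite exprMn [X in _ + X = _]invfM (_ : 2 ^+ 2 = 4); last by ring.
by rewrite mulrDr addrA; congr (_ + _); rewrite addrAC.
Qed.

Lemma trigamma1_0 : trigamma1 R 0 = pi ^+ 2 / 6.
Proof.
have cz := is_cvg_hterm R 0 (ltrN10 _); set Z := trigamma1 R 0.
have pi0 := pi_gt0 R.
pose P := series (hterm R 0).
have PE n : P n = \sum_(0 <= k < n) ((k.+1)%:R ^+ 2)^-1.
  by apply: eq_bigr => k _; rewrite /hterm addr0 natr1.
have PZ : P @ \oo --> Z by exact: cz.
have h0 k : 0 <= hterm R 0 k by rewrite ltW// hterm_gt0// ltrN10.
have P_le_Z n : P n <= Z by exact: series_le_lim.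
have P_homo m n : (m <= n)%N -> P m <= P n.
  by apply: nondecreasing_series => k _ _; exact: h0.
have n2 n : (n < 2 ^ n)%N by exact: ltn_expl.
have odd n := sum_invsq_split (2 ^ n).
have bnd := sum_invsq_odd_bounds.
have upper n : P n - Z / 4 <= pi ^+ 2 / 8.
  have /andP[_] := bnd n; have := odd n; rewrite -!PE => oddn.
  have := P_homo _ _ (ltnW (leq_trans (n2 n) (leq_addr (2 ^ n) _))).
  by rewrite addnn; have := P_le_Z (2 ^ n)%N; lra.
have lower n : pi ^+ 2 / 8 - pi ^+ 2 / 16 * harmonic n <= Z - P n / 4.
  have /andP[+ _] := bnd n; have := odd n; rewrite -!PE => oddn.
  have := P_homo _ _ (ltnW (n2 n)); have := P_le_Z (2 ^ n).*2.
  have : pi ^+ 2 / 16 / 2 ^+ n <= pi ^+ 2 / 16 * harmonic n :> R.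
    rewrite ler_wpM2l ?divr_ge0 ?exprn_ge0 ?(ltW pi0)// lef_pV2 ?posrE ?exprn_gt0//.
    by rewrite -natrX ler_nat.
  lra.
have ub : Z - Z / 4 <= pi ^+ 2 / 8.
  have cu : (fun n => P n - Z / 4) @ \oo --> Z - Z / 4.
    by apply: cvgB => //; exact: cvg_cst.
  rewrite -(cvg_lim _ cu)//; apply: limr_le; first exact: cvgP cu.
  by near=> n; exact: upper.
have lb : pi ^+ 2 / 8 - pi ^+ 2 / 16 * 0 <= Z - Z / 4.
  have cl : (fun n => pi ^+ 2 / 8 - pi ^+ 2 / 16 * harmonic n) @ \oo -->
      pi ^+ 2 / 8 - pi ^+ 2 / 16 * 0.
    by apply: cvgB; [exact: cvg_cst|apply: cvgMr; exact: cvg_harmonic].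
  have cu : (fun n => Z - P n / 4) @ \oo --> Z - Z / 4.
    by apply: cvgB; [exact: cvg_cst|apply: cvgMl].
  rewrite -(cvg_lim _ cu)// -(cvg_lim _ cl)//.
  apply: ler_lim; [exact: cvgP cl|exact: cvgP cu|].
  by near=> n; exact: lower.
lra.
Unshelve. all: by end_near. Qed.

Lemma trigamma1_0_x0 : trigamma1 R 0 = (x0 R)^-1.
Proof. by rewrite trigamma1_0 /x0 invf_div. Qed.

Lemma trigamma1_1_x1 : trigamma1 R 1 = (x1 R)^-1.
Proof. by rewrite trigamma1_shift trigamma1_0 /x1 invrK. Qed.

End Basel.

(** * Large deviation bounds *)

Section LargeDeviations.
Variable R : realType.
Implicit Types (r s l x : R) (n m : nat).
Local Notation g := (@gdiff R).
Local Notation h := (@trigamma1 R).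

Lemma near_le_expR_ln (C e : R) : 0 < e ->
  \forall n \near \oo, C <= expR (e * ln n%:R).
Proof.
move=> e0; near=> n.
have n0 : 0 < n%:R :> R by near: n; exact: nbhs_infty_gtr.
have : expR (C / e) <= n%:R by near: n; exact: nbhs_infty_ger.
rewrite -[leRHS](@lnK R)// ler_expR ler_pdivrMr// mulrC => Cn.
by apply: le_trans Cn (le_trans _ (expR_ge1Dx _)); rewrite lerDr.
Unshelve. all: by end_near. Qed.

Lemma gdiff_lt1 r : -1 < r < 1 -> g r < 1.
Proof. by move=> /andP[r1 r2]; rewrite -gdiff1 gdiff_lt. Qed.

Lemma totrateB_hsum_bounded r : -1 < r ->
  exists M : R, forall m, `|totrate R m - hsum R r m| <= M.
Proof.
move=> r1; have [M [_ hM]] := cvg_seq_bounded (is_cvg_gterm R r r1).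
have {}hM := hM (M + 1) (ltr_pwDr ltr01 (lexx _)).
exists (M + 1) => -[|m]; last by rewrite totrateB_hsum; exact: hM.
rewrite totrateE /hsum !big_geq// subrr normr0.
exact: le_trans (normr_ge0 _) (hM 0%N I).
Qed.

Lemma near_le_totrateB_hsum r l : -1 < r -> l < g r ->
  exists m0, forall m, (m0 <= m)%N -> l <= totrate R m - hsum R r m.
Proof.
move=> r1 lr; have [N _ hN] := cvgr_ge _ (is_cvg_gterm R r r1) l lr.
by exists N.+1 => -[|m]// Nm; rewrite totrateB_hsum; exact: hN.
Qed.

Lemma near_totrateB_hsum_le r l : -1 < r -> g r < l ->
  exists m0, forall m, (m0 <= m)%N -> totrate R m - hsum R r m <= l.
Proof.
move=> r1 lr; have [N _ hN] := cvgr_le _ (is_cvg_gterm R r r1) l lr.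
by exists N.+1 => -[|m]// Nm; rewrite totrateB_hsum; exact: hN.
Qed.

Lemma near_mgf_le r (e : R) : -1 < r < 1 -> 0 < e ->
  \forall n \near \oo, mgf R (g r) n <= expR ((r + e) * ln n%:R).
Proof.
move=> rI e0; have l1 := gdiff_lt1 r rI; have /andP[r1 _] := rI.
pose r' := r + e / 2; have r'1 : -1 < r' by rewrite /r'; lra.
have lt_rr' : r < r' by rewrite /r'; lra.
have [m0 super] := near_le_totrateB_hsum r' (g r) r'1 (gdiff_lt R r r' r1 lt_rr').
have [C C0 hC] := mgf_le_growth R r' (g r) m0 r'1 l1 super.
have [M hM] := totrateB_hsum_bounded r' r'1.
have [D D0 hD] := growth_power_bounds R r' M r'1 hM.
near=> n.
have n0 : (0 < n)%N by near: n; exact: nbhs_infty_gt.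
apply: le_trans (hC n) _.
apply: le_trans (ler_wpM2l (ltW C0) (hD n n0).1) _.
have -> : r + e = e / 2 + r' by rewrite /r'; lra.
rewrite [in leRHS]mulrDl [in leRHS]expRD mulrA ler_wpM2r ?expR_ge0//.
by near: n; apply: near_le_expR_ln; lra.
Unshelve. all: by end_near. Qed.

Lemma near_mgf_ge r (e : R) : -1 < r < 1 -> 0 < e ->
  \forall n \near \oo, expR ((r - e) * ln n%:R) <= mgf R (g r) n.
Proof.
move=> rI e0; have l1 := gdiff_lt1 r rI; have /andP[r1 _] := rI.
pose r' := Num.max (r - e / 2) ((r - 1) / 2).
have r'1 : -1 < r' by rewrite /r' lt_max; apply/orP; right; lra.
have lt_rr' : r' < r by rewrite /r' gt_max; apply/andP; split; lra.
have r'e : r - e / 2 <= r' by rewrite /r' le_max lexx.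
have [m0 sub] := near_totrateB_hsum_le r' (g r) r'1 (gdiff_lt R r' r r'1 lt_rr').
have [C C0 hC] := growth_le_mgf R r' (g r) m0 r'1 l1 sub.
have [M hM] := totrateB_hsum_bounded r' r'1.
have [D D0 hD] := growth_power_bounds R r' M r'1 hM.
near=> n.
have n0 : (0 < n)%N by near: n; exact: nbhs_infty_gt.
have ln0 : 0 <= ln n%:R :> R by rewrite ln_ge0// ler1n.
have mgf0 := mgf_gt0 R (g r) n l1.
have large : D * C <= expR (e / 2 * ln n%:R).
  by near: n; apply: near_le_expR_ln; lra.
have : expR (r' * ln n%:R) <= expR (e / 2 * ln n%:R) * mgf R (g r) n.
  apply: le_trans (hD n n0).2 _.
  apply: le_trans (ler_wpM2l (ltW D0) (hC n)) _.
  by rewrite mulrA ler_wpM2r// ltW.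
rewrite -ler_pdivrMl ?expR_gt0// -expRN -expRD.
by apply: le_trans; rewrite ler_expR -mulNr -mulrDl ler_wpM2r//; lra.
Unshelve. all: by end_near. Qed.

Lemma PrD_chernoff l (a : R) n (S : set R) : l < 1 ->
  (forall y, S y -> 0 <= l * (y - a)) ->
  (PrD n S <= (expR (- (l * a)) * mgf R l n)%:E)%E.
Proof.
move=> l1 hS.
have := @lawtbl_le R 1 (fun=> l) (fun=> l1) n n S (fun=> expR (- (l * a))).
rewrite big_ord_recl big_ord0 addr0; apply => // y.
rewrite big_ord_recl big_ord0 addr0 -expRD addrC -mulrBr indicE.
have [/set_mem Sy|_] := boolP (y \in S); last exact: expR_ge0.
by apply: le_trans (expR_ge1Dx _); rewrite lerDl hS.
Qed.

(* On the complement of the window ]A, B[ one of the two subtracted exponentials dominates [exp (l y)]. *)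
Lemma PrD_window_ge l lm lp (A B w : R) n (S : set R) :
  lm < l -> l < lp -> lp < 1 ->
  (forall y, A < y < B -> S y) -> (forall y, A < y < B -> l * y <= w) ->
  ((expR (- w) * (mgf R l n - expR (- ((lp - l) * B)) * mgf R lp n
     - expR ((l - lm) * A) * mgf R lm n))%:E <= PrD n S)%E.
Proof.
move=> lml llp lp1 hS hw.
pose ls (i : 'I_3) := [:: l; lp; lm]`_i.
pose cs (i : 'I_3) := [:: expR (- w); - (expR (- w) * expR (- ((lp - l) * B)));
  - (expR (- w) * expR ((l - lm) * A))]`_i.
have ls1 i : ls i < 1.
  by case: i => -[|[|[|//]]] ? //=; rewrite /ls /=; lra.
have := @lawtbl_ge R 3 ls ls1 n n S cs (leqnSn _).
rewrite !big_ord_recl big_ord0 /ls /cs /= addr0.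
have -> : expR (- w) * mgf R l n + (- (expR (- w) * expR (- ((lp - l) * B))) *
    mgf R lp n + - (expR (- w) * expR ((l - lm) * A)) * mgf R lm n) =
  expR (- w) * (mgf R l n - expR (- ((lp - l) * B)) * mgf R lp n
     - expR ((l - lm) * A) * mgf R lm n) by ring.
apply => y; rewrite !big_ord_recl big_ord0 /= addr0.
have -> : expR (- w) * expR (l * y) + (- (expR (- w) * expR (- ((lp - l) * B))) *
    expR (lp * y) + - (expR (- w) * expR ((l - lm) * A)) * expR (lm * y)) =
  expR (- w) * (expR (l * y) - expR (lp * y - (lp - l) * B) -
     expR (lm * y + (l - lm) * A)) by rewrite !expRD; ring.
have p1 := expR_ge0 (lp * y - (lp - l) * B).
have p2 := expR_ge0 (lm * y + (l - lm) * A).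
have ind0 : 0 <= \1_S y :> R by [].
have nonpos : expR (l * y) - expR (lp * y - (lp - l) * B) -
     expR (lm * y + (l - lm) * A) <= 0 -> expR (- w) * (expR (l * y) -
     expR (lp * y - (lp - l) * B) - expR (lm * y + (l - lm) * A)) <= \1_S y.
  by move=> le0; apply: le_trans ind0; rewrite mulr_ge0_le0 ?expR_ge0.
have [yA|Ay] := leP y A.
  apply: nonpos; have : expR (l * y) <= expR (lm * y + (l - lm) * A).
    by rewrite ler_expR; nra.
  lra.
have [By|yB] := leP B y.
  apply: nonpos; have : expR (l * y) <= expR (lp * y - (lp - l) * B).
    by rewrite ler_expR; nra.
  lra.
have yI : A < y < B by rewrite Ay.
rewrite indicE mem_set; last exact: hS.
apply: (@le_trans _ _ (expR (- w) * expR (l * y))).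
  by rewrite ler_wpM2l ?expR_ge0//; lra.
by rewrite -expRD -[leRHS]expR0 ler_expR; have := hw y yI; lra.
Qed.

(* The exponentially tilted chain at [s] concentrates between [ln n / h a] and [ln n / h b]. *)
Lemma near_PrD_window_ge (a s b c e : R) (S : nat -> set R) :
  -1 < a -> a < s -> s < b -> b < 1 -> 0 < e ->
  (forall n y, ln n%:R / h a < y < ln n%:R / h b -> S n y) ->
  (forall n y, ln n%:R / h a < y < ln n%:R / h b -> g s * y <= g s * c * ln n%:R) ->
  \forall n \near \oo,
    ((expR ((s - g s * c - e) * ln n%:R))%:E <= PrD n (S n))%E.
Proof.
move=> a1 as_ sb b1 e0 hS hc.
pose v := (a + s) / 2; pose u := (s + b) / 2.
have [av vs] : a < v /\ v < s by rewrite /v; split; lra.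
have [su ub] : s < u /\ u < b by rewrite /u; split; lra.
have [v1 s1] : -1 < v /\ -1 < s by split; lra.
have u1 : -1 < u by lra.
have vI : -1 < v < 1 by lra.
have sI : -1 < s < 1 by lra.
have uI : -1 < u < 1 by lra.
have ha := trigamma1_gt0 R a a1.
have hb : 0 < h b by apply: trigamma1_gt0; lra.
pose d1 := s - v - (g s - g v) / h a.
pose d2 := (g u - g s) / h b - (u - s).
have d1_gt0 : 0 < d1.
  rewrite /d1 subr_gt0 ltr_pdivrMr//; have /andP[_ /le_lt_trans] := gdiff_secant R v s v1 vs.
  by apply; rewrite ltr_pM2l ?subr_gt0// trigamma1_lt.
have d2_gt0 : 0 < d2.
  rewrite /d2 subr_gt0 ltr_pdivlMr//; have /andP[+ _] := gdiff_secant R s u s1 su.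
  by apply: lt_le_trans; rewrite ltr_pM2l ?subr_gt0// trigamma1_lt.
pose t := Num.min e (Num.min d1 d2) / 4.
have t0 : 0 < t by rewrite /t divr_gt0// !lt_min e0 d1_gt0.
have te : 4 * t <= e by rewrite /t mulrCA mulfV// mulr1 ge_min lexx.
have td1 : 4 * t <= d1 by rewrite /t mulrCA mulfV// mulr1 !ge_min lexx orbT.
have td2 : 4 * t <= d2 by rewrite /t mulrCA mulfV// mulr1 !ge_min lexx !orbT.
near=> n.
have n0 : (0 < n)%N by near: n; exact: nbhs_infty_gt.
have L0 : 0 <= ln n%:R :> R by rewrite ln_ge0// ler1n.
have X3 : 3 <= expR (2 * t * ln n%:R).
  by near: n; apply: near_le_expR_ln; lra.
have ms : expR ((s - t) * ln n%:R) <= mgf R (g s) n.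
  by near: n; exact: near_mgf_ge.
have mu : mgf R (g u) n <= expR ((u + t) * ln n%:R).
  by near: n; exact: near_mgf_le.
have mv : mgf R (g v) n <= expR ((v + t) * ln n%:R).
  by near: n; exact: near_mgf_le.
have gvs : g v < g s by exact: gdiff_lt.
have gsu : g s < g u by exact: gdiff_lt.
have := PrD_window_ge (g s) (g v) (g u) (ln n%:R / h a) (ln n%:R / h b)
  (g s * c * ln n%:R) n (S n) gvs gsu (gdiff_lt1 u uI) (hS n) (hc n).
apply: le_trans; rewrite lee_fin.
have eu : expR (- ((g u - g s) * (ln n%:R / h b))) * mgf R (g u) n <=
    expR ((s - 3 * t) * ln n%:R).
  apply: le_trans (ler_wpM2l (expR_ge0 _) mu) _; rewrite -expRD ler_expR.
  have -> : - ((g u - g s) * (ln n%:R / h b)) + (u + t) * ln n%:R =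
    (s - d2 + t) * ln n%:R by rewrite /d2; ring.
  by rewrite ler_wpM2r//; lra.
have ev : expR ((g s - g v) * (ln n%:R / h a)) * mgf R (g v) n <=
    expR ((s - 3 * t) * ln n%:R).
  apply: le_trans (ler_wpM2l (expR_ge0 _) mv) _; rewrite -expRD ler_expR.
  have -> : (g s - g v) * (ln n%:R / h a) + (v + t) * ln n%:R =
    (s - d1 + t) * ln n%:R by rewrite /d1; ring.
  by rewrite ler_wpM2r//; lra.
have es : 3 * expR ((s - 3 * t) * ln n%:R) <= mgf R (g s) n.
  apply: le_trans ms.
  have -> : (s - t) * ln n%:R = 2 * t * ln n%:R + (s - 3 * t) * ln n%:R by ring.
  by rewrite expRD ler_wpM2r ?expR_ge0.
apply: (@le_trans _ _
  (expR (- (g s * c * ln n%:R)) * expR ((s - 3 * t) * ln n%:R))).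
  rewrite -expRD ler_expR.
  have -> : - (g s * c * ln n%:R) + (s - 3 * t) * ln n%:R =
    (s - g s * c - 3 * t) * ln n%:R by ring.
  by rewrite ler_wpM2r//; lra.
rewrite ler_wpM2l ?expR_ge0//; lra.
Unshelve. all: by end_near. Qed.

Lemma LambdaStar_image x : LambdaStar x =
  ereal_sup (EFin @` [set x * g r - r | r in [set r | -1 < r < 1]]).
Proof.
rewrite /LambdaStar; congr ereal_sup; apply/seteqP; split => z /=.
- move=> [l l1 <-]; have [r rI <-] := gdiff_surj R l l1.
  exists (x * g r - r); first by exists r.
  by rewrite rho_gdiff//; have /andP[] := rI.
- move=> [w [r rI <-] <-]; exists (g r); first exact: gdiff_lt1.
  by rewrite rho_gdiff//; have /andP[] := rI.
Qed.

Lemma LambdaStar_fin x : 0 <= x -> exists L : R,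
  [/\ LambdaStar x = L%:E, forall r, -1 < r < 1 -> x * g r - r <= L
    & forall e, 0 < e -> exists2 r, -1 < r < 1 & L - e < x * g r - r].
Proof.
move=> x0; pose A := [set x * g r - r | r in [set r | -1 < r < 1]].
have ubA : has_ubound A.
  exists (x + 1) => _ [r rI <-]; have := gdiff_lt1 r rI.
  by have /andP[r1 _] := rI; nra.
have A0 : A !=set0 by exists (x * g 0 - 0), 0 => //=; rewrite ltr01 ltrN10.
exists (sup A); split.
- by rewrite LambdaStar_image ereal_sup_EFin.
- by move=> r rI; apply: ub_le_sup => //; exists r.
- move=> e e0; have [_ [r rI <-] hr] := sup_adherent e0 (conj A0 ubA).
  by exists r.
Qed.

Lemma near_PrD_le x (L e : R) r (S : nat -> set R) : -1 < r < 1 -> 0 < e ->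
  L - e / 2 < x * g r - r ->
  (forall n y, S n y -> 0 <= g r * (y - x * ln n%:R)) ->
  \forall n \near \oo, (PrD n (S n) <= (n%:R `^ (- L + e))%:E)%E.
Proof.
move=> rI e0 hL hS; near=> n.
have n0 : (0 < n)%N by near: n; exact: nbhs_infty_gt.
have L0 : 0 <= ln n%:R :> R by rewrite ln_ge0// ler1n.
apply: le_trans (PrD_chernoff (g r) (x * ln n%:R) n (S n) (gdiff_lt1 r rI) (hS n)) _.
rewrite lee_fin /powR pnatr_eq0 gtn_eqF//.
have : mgf R (g r) n <= expR ((r + e / 2) * ln n%:R).
  by near: n; apply: near_mgf_le => //; lra.
move=> /(ler_wpM2l (expR_ge0 (- (g r * (x * ln n%:R))))) /le_trans; apply.
rewrite -expRD ler_expR.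
have -> : - (g r * (x * ln n%:R)) + (r + e / 2) * ln n%:R =
  (- (x * g r) + r + e / 2) * ln n%:R by ring.
by rewrite ler_wpM2r//; lra.
Unshelve. all: by end_near. Qed.

Lemma gdiff_le0 r : -1 < r -> r <= 0 -> g r <= 0.
Proof.
move=> r1; rewrite le_eqVlt => /predU1P[->|r0]; first by rewrite gdiff0.
by rewrite -(gdiff0 R) ltW// gdiff_lt.
Qed.

Lemma gdiff_ge0 r : 0 <= r -> 0 <= g r.
Proof.
rewrite le_eqVlt => /predU1P[<-|r0]; first by rewrite gdiff0.
by rewrite -(gdiff0 R) ltW// gdiff_lt// ltrN10.
Qed.

Lemma x0_gt0 : 0 < x0 R.
Proof. by rewrite /x0 divr_gt0// exprn_gt0// pi_gt0. Qed.

Lemma x0_gdiff_le r : -1 < r -> x0 R * g r <= r.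
Proof.
move=> r1; have := gdiff_le R r r1; rewrite trigamma1_0_x0.
by rewrite -ler_pdivlMl ?x0_gt0// => /le_trans; apply; rewrite mulrC.
Qed.

Lemma near_PrD_gt_le x (L e : R) : x0 R <= x -> LambdaStar x = L%:E -> 0 < e ->
  \forall n \near \oo,
    (PrD n [set y : R | (x * ln n%:R < y)%R] <= (n%:R `^ (- L + e))%:E)%E.
Proof.
move=> x0x + e0; have xpos := lt_le_trans x0_gt0 x0x.
have [L' [-> _ adh]] := LambdaStar_fin x (ltW xpos) => -[<-].
have [r [rI r0] hr] : exists2 r, -1 < r < 1 /\ 0 <= r & L' - e / 2 < x * g r - r.
  have [r rI hr] := adh (e / 2) (divr_gt0 e0 (ltr0Sn _ _)).
  have [r0|r0] := leP 0 r; first by exists r.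
  exists 0; first by rewrite lexx ltr01 ltrN10.
  apply: lt_le_trans hr _; rewrite gdiff0 mulr0 subrr subr_le0.
  have /andP[r1 _] := rI; apply: le_trans (x0_gdiff_le r r1).
  by rewrite ler_wnM2r// gdiff_le0// ltW.
apply: (near_PrD_le x L' e r) => // n y /=; rewrite -subr_gt0 => yx.
by rewrite mulr_ge0 ?gdiff_ge0// ltW.
Qed.

Lemma near_PrD_lt_le x (L e : R) : 0 < x <= x0 R -> LambdaStar x = L%:E -> 0 < e ->
  \forall n \near \oo,
    (PrD n [set y : R | (y < x * ln n%:R)%R] <= (n%:R `^ (- L + e))%:E)%E.
Proof.
move=> /andP[xpos xx0] + e0.
have [L' [-> _ adh]] := LambdaStar_fin x (ltW xpos) => -[<-].
have [r [rI r0] hr] : exists2 r, -1 < r < 1 /\ r <= 0 & L' - e / 2 < x * g r - r.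
  have [r rI hr] := adh (e / 2) (divr_gt0 e0 (ltr0Sn _ _)).
  have [r0|r0] := leP r 0; first by exists r.
  exists 0; first by rewrite lexx ltr01 ltrN10.
  apply: lt_le_trans hr _; rewrite gdiff0 mulr0 subrr subr_le0.
  have /andP[r1 _] := rI; apply: le_trans (x0_gdiff_le r r1).
  by rewrite ler_wpM2r// gdiff_ge0// ltW.
apply: (near_PrD_le x L' e r) => // n y /=; rewrite -subr_lt0 => yx.
by rewrite mulr_le0 ?gdiff_le0 ?(ltW yx)//; have /andP[] := rI.
Qed.

Lemma LambdaStar_tangent r : -1 < r < 1 ->
  LambdaStar ((h r)^-1) = (g r / h r - r)%:E.
Proof.
move=> rI; have /andP[r1 _] := rI; have hr := trigamma1_gt0 R r r1.
have hV0 : 0 <= (h r)^-1 by rewrite invr_ge0 ltW.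
have [L [-> ub adh]] := LambdaStar_fin _ hV0; congr EFin.
apply/eqP; rewrite eq_le [g r / _]mulrC ub// andbT.
apply/ler_addgt0Pr => e e0; have [s sI /ltW hs] := adh e e0.
rewrite -lerBlDr; apply: le_trans hs _.
have /andP[s1 _] := sI.
suff : (h r)^-1 * (g s - g r) <= s - r by rewrite mulrBr; lra.
rewrite mulrC ler_pdivrMr//; have [rs|sr|->] := ltgtP r s.
- by have /andP[] := gdiff_secant R r s r1 rs.
- by have /andP[+ _] := gdiff_secant R s r s1 sr; lra.
- by rewrite !subrr mul0r.
Qed.

Lemma near_LambdaStar_exponent r (e : R) : -1 < r -> 0 < e ->
  \forall s \near r, g s / h (2 * s - r) - s < g r / h r - r + e.
Proof.
move=> r1 e0; have hr := trigamma1_gt0 R r r1.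
pose F s := g s / h (2 * s - r) - s.
have Fr : F r = g r / h r - r by rewrite /F; congr (_ / h _ - _); ring.
have cF : F s @[s --> r] --> F r.
  rewrite /F; apply: cvgB; last exact: cvg_id.
  have e2 : 2 * r - r = r by ring.
  apply: cvgM; first exact: continuous_gdiff.
  apply: cvgV; first by rewrite e2 lt0r_neq0.
  apply: (@continuous_comp _ _ _ (fun s => 2 * s - r) h r).
    by apply: cvgB; [apply: cvgMr; exact: cvg_id|exact: cvg_cst].
  by rewrite /= e2; exact: continuous_trigamma1.
by apply: (cvgr_lt _ cF); rewrite Fr ltrDl.
Qed.

Lemma near_PrD_gt_ge r (e : R) : 0 <= r < 1 -> 0 < e ->
  \forall n \near \oo,
    ((n%:R `^ (- (g r / h r - r) - e))%:E
       <= PrD n [set y : R | ((h r)^-1 * ln n%:R < y)%R])%E.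
Proof.
move=> /andP[r0 r1] e0; have rN1 : -1 < r by lra.
have [s [rs s1 hs]] : exists s, [/\ r < s, 2 * s - r < 1 &
    g s / h (2 * s - r) - s < g r / h r - r + e / 2].
  have he : \forall s \near r^'+, g s / h (2 * s - r) - s < g r / h r - r + e / 2.
    by apply: cvg_within; apply: near_LambdaStar_exponent => //; lra.
  near r^'+ => s; exists s; split; last by near: s.
  - by near: s; exact: nbhs_right_gt.
  - suff : s < (1 + r) / 2 by lra.
    by near: s; apply: nbhs_right_lt; lra.
have gs : 0 < g s by rewrite -(gdiff0 R) gdiff_lt ?ltrN10//; lra.
near=> n.
have n0 : (0 < n)%N by near: n; exact: nbhs_infty_gt.
have L0 : 0 <= ln n%:R :> R by rewrite ln_ge0// ler1n.
rewrite /powR pnatr_eq0 gtn_eqF//.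
apply: (@le_trans _ _
  (expR ((s - g s * (h (2 * s - r))^-1 - e / 2) * ln n%:R))%:E).
  by rewrite lee_fin ler_expR ler_wpM2r//; lra.
near: n; apply: (near_PrD_window_ge r s (2 * s - r)) => //; try lra.
- by move=> n y /andP[+ _] /=; rewrite mulrC.
- by move=> n y /andP[_ /ltW yb]; rewrite -mulrA ler_pM2l// mulrC.
Unshelve. all: by end_near. Qed.

Lemma near_PrD_lt_ge r (e : R) : -1 < r <= 0 -> 0 < e ->
  \forall n \near \oo,
    ((n%:R `^ (- (g r / h r - r) - e))%:E
       <= PrD n [set y : R | (y < (h r)^-1 * ln n%:R)%R])%E.
Proof.
move=> /andP[rN1 r0] e0.
have [s [rs s1 hs]] : exists s, [/\ s < r, -1 < 2 * s - r &
    g s / h (2 * s - r) - s < g r / h r - r + e / 2].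
  have he : \forall s \near r^'-, g s / h (2 * s - r) - s < g r / h r - r + e / 2.
    by apply: cvg_within; apply: near_LambdaStar_exponent => //; lra.
  near r^'- => s; exists s; split; last by near: s.
  - by near: s; exact: nbhs_left_lt.
  - suff : (-1 + r) / 2 < s by lra.
    by near: s; apply: nbhs_left_gt; lra.
have gs : g s < 0 by rewrite -(gdiff0 R) gdiff_lt//; lra.
near=> n.
have n0 : (0 < n)%N by near: n; exact: nbhs_infty_gt.
have L0 : 0 <= ln n%:R :> R by rewrite ln_ge0// ler1n.
rewrite /powR pnatr_eq0 gtn_eqF//.
apply: (@le_trans _ _
  (expR ((s - g s * (h (2 * s - r))^-1 - e / 2) * ln n%:R))%:E).
  by rewrite lee_fin ler_expR ler_wpM2r//; lra.
near: n; apply: (near_PrD_window_ge (2 * s - r) s r) => //; try lra.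
- by move=> n y /andP[_ +] /=; rewrite mulrC.
- by move=> n y /andP[/ltW ya _]; rewrite -mulrA ler_nM2l// mulrC.
Unshelve. all: by end_near. Qed.

Lemma x1_gt0 : 0 < x1 R.
Proof. by rewrite -invr_gt0 -trigamma1_1_x1 trigamma1_gt0//; lra. Qed.

Lemma exists_tangent x : 0 < x < x1 R ->
  exists2 r, -1 < r < 1 & (h r)^-1 = x.
Proof.
move=> /andP[x0 xx1].
have : h 1 < x^-1 by rewrite trigamma1_1_x1 ltf_pV2 ?posrE ?x1_gt0.
by move=> /trigamma1_surj[r rI hr]; exists r => //; rewrite hr invrK.
Qed.

End LargeDeviations.

Theorem theorem13p7 (R : realType) :
  (forall x : R, 0 < x <= x0 R ->
     exists L : R, LambdaStar x = L%:E /\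
       forall eps : R, 0 < eps -> \forall n \near \oo,
         ((n%:R `^ (- L - eps))%R%:E <= PrD n [set y : R | (y < x * ln (n%:R : R))%R]
          <= (n%:R `^ (- L + eps))%R%:E)%E) /\
  (forall x : R, x0 R <= x < x1 R ->
     exists L : R, LambdaStar x = L%:E /\
       forall eps : R, 0 < eps -> \forall n \near \oo,
         ((n%:R `^ (- L - eps))%R%:E <= PrD n [set y : R | (x * ln (n%:R : R) < y)%R]
          <= (n%:R `^ (- L + eps))%R%:E)%E) /\
  (forall x : R, x1 R <= x ->
     exists L : R, LambdaStar x = L%:E /\
       forall eps : R, 0 < eps -> \forall n \near \oo,
         (PrD n [set y : R | (x * ln (n%:R : R) < y)%R] <= (n%:R `^ (- L + eps))%R%:E)%E).
Proof.
have x00 := x0_gt0 R.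
have x01 : x0 R < x1 R.
  by rewrite -ltf_pV2 ?posrE ?x1_gt0// -trigamma1_0_x0 -trigamma1_1_x1 trigamma1_lt.
split; [|split] => x.
- move=> xI; have /andP[xpos xx0] := xI.
  have [|r rI hx] := exists_tangent R x; first by rewrite xpos (le_lt_trans xx0).
  have /andP[rN1 _] := rI; subst x; have hr := trigamma1_gt0 R r rN1.
  have r0 : r <= 0.
    rewrite leNgt; apply/negP => r0; move: xx0; rewrite leNgt => /negP; apply.
    by rewrite -ltf_pV2 ?posrE ?invr_gt0// invrK -trigamma1_0_x0 trigamma1_lt.
  have LE := LambdaStar_tangent R r rI.
  exists (gdiff R r / trigamma1 R r - r); split => // eps eps0.
  near=> n; apply/andP; split; near: n; last exact: near_PrD_lt_le.
  by apply: near_PrD_lt_ge; rewrite ?rN1.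
- move=> /andP[xx0 xx1]; have xpos := lt_le_trans x00 xx0.
  have [|r rI hx] := exists_tangent R x; first by rewrite xpos.
  have /andP[rN1 r1] := rI; subst x; have hr := trigamma1_gt0 R r rN1.
  have r0 : 0 <= r.
    rewrite leNgt; apply/negP => r0; move: xx0; rewrite leNgt => /negP; apply.
    by rewrite -ltf_pV2 ?posrE ?invr_gt0// invrK -trigamma1_0_x0 trigamma1_lt.
  have LE := LambdaStar_tangent R r rI.
  exists (gdiff R r / trigamma1 R r - r); split => // eps eps0.
  near=> n; apply/andP; split; near: n; last exact: near_PrD_gt_le.
  by apply: near_PrD_gt_ge; rewrite ?r0.
- move=> xx1; have x0x := ltW (lt_le_trans x01 xx1).
  have [L [LE _ _]] := LambdaStar_fin R x (le_trans (ltW x00) x0x).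
  by exists L; split => // eps eps0; exact: near_PrD_gt_le.
Unshelve. all: by end_near. Qed.
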